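(* Let $\sigma>0$ and $f\in B_\sigma$. Under the interpolation conditions described in the context, for any fixed $b_0>0$ and $0<\delta\le\delta_0$, the optimal value of $\beta$ in the interval $(0,\beta_0]$, where $$\beta_0=\frac{1}{3^{3/2}\cdot 2\rho\, n\, e^{4n\gamma_n+2}\, b_0^{3/2}\sqrt{\gamma_n}\,\sqrt{\delta}},$$ is the number minimizing $$MN(\beta):=\beta^{\frac{b_0}{4\gamma_n\delta}}\,e^{\frac{\sigma^2}{8\beta}},\qquad \beta\in(0,\beta_0].$$
   Context: Here $n\ge1$ is the dimension; $\gamma_1=2$ and $\gamma_n=2n(1+\gamma_{n-1})$ for $n\ge 2$; $\rho=\sqrt3/e$; $\alpha_n$ is the volume of the unit ball in $R^n$. $B_\sigma=\{f\in L^2(R^n):\hat f(\xi)=0\text{ if }|\xi|>\sigma\}$, where $\hat f$ denotes the Fourier transform of $f$. Interpolation conditions: $h(x)=e^{-\beta|x|^2}$, $x\in R^n$, $\beta>0$, is the Gaussian with shape parameter $\beta$. For $X=\{x_1,\dots,x_N\}\subset R^n$, the $h$ spline interpolating $f$ on $X$ is $s(x)=\sum_{j=1}^N c_jh(x-x_j)$ with $s(x_i)=f(x_i)$ for $i=1,\dots,N$. The point $x$ lies in a cube $E$ of side $b\ge b_0$, $0<\delta\le\delta_0$, and every subcube of $E$ of side $\delta$ contains a point of $X$. Here $$\delta_0=\min\left\{\frac{1}{(3^{3/4}\,e\,\sqrt{2\rho\beta}\,\sqrt n\,e^{2n\gamma_n})^4\,b_0^3\,\gamma_n},\ \delta_n\right\},$$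 with $\delta_n=\frac{b_0}{2\gamma_n}$ if $n=1$ or $n=2$, $\delta_n=\frac{b_0}{2\gamma_n(n-1)}$ if $n>1$ is odd, and $\delta_n=\frac{b_0}{2\gamma_n(n-2)}$ if $n>2$ is even. Note that $\delta_0$ depends on $\beta$; the condition $\delta\le\delta_0$ is equivalent to $\delta\le\delta_n$ together with $\beta\le\beta_0$. Under these conditions the interpolation error satisfies $$|f(x)-s(x)|\le\Delta''(C\delta)^{c/\delta}(2\pi)^{-n}e^{\frac{\sigma^2}{8\beta}}\|f\|_{L^2(R^n)}\quad\text{for all }x\in E,$$ where $c=\frac{b_0}{8\gamma_n}$, $C=(3^{3/4}\,e\,\sqrt{2\rho\beta}\,\sqrt n\,e^{2n\gamma_n})^4\,b_0^3\,\gamma_n$, $\Delta''=\pi^{\frac{n-1}{4}}(n\alpha_n)^{1/2}2^{\frac{n+1}{4}}\rho^{\frac{n-2}{4}}$ for even $n$ and $\Delta''=\pi^{\frac n4}(n\alpha_n)^{1/2}\rho^{\frac{n-1}{4}}$ for odd $n$. ''Optimal'' means that the right-hand side of this error bound, as a function of $\beta$, is minimal. *)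

(* Defs.v *)
From HB Require Import structures.
From mathcomp Require Import all_boot all_order all_algebra.
From mathcomp Require Import ring complex.
From mathcomp Require Import all_classical all_reals all_analysis.

Set Implicit Arguments.
Unset Strict Implicit.
Unset Printing Implicit Defensive.
Import Order.TTheory GRing.Theory Num.Theory.
Import numFieldNormedType.Exports.

Local Open Scope classical_set_scope.
Local Open Scope ring_scope.
Local Open Scope complex_scope.

(* R^n is represented by n-tuples because these carry the Borel (product)
   sigma-algebra. *)
Definition Rn (R : realType) (n : nat) := n.-tuple (measurableTypeR R).

(* Lebesgue measure on R^n: iterated product of the one-dimensional Lebesgue
   measure, transported along (x, t) |-> x :: t. *)
Section lebesgue_succ.
Context (R : realType) (n : nat).

Definition cons_Rn (p : measurableTypeR R * Rn R n) : Rn R n.+1 :=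
  [tuple of p.1 :: p.2].

Lemma measurable_cons_Rn : measurable_fun setT cons_Rn.
Proof. exact: measurable_cons. Qed.

Variable m : {sigma_finite_measure set (Rn R n) -> \bar R}.

Definition lebesgue_succ : set (Rn R n.+1) -> \bar R :=
  pushforward (lebesgue_measure \x m)%E cons_Rn.

Let lebesgue_succ0 : lebesgue_succ set0 = 0%E.
Proof. by rewrite /lebesgue_succ /pushforward preimage_set0 measure0. Qed.

Let lebesgue_succ_ge0 A : (0 <= lebesgue_succ A)%E.
Proof. by rewrite /lebesgue_succ /pushforward; exact: measure_ge0. Qed.

Let lebesgue_succ_sigma_additive : semi_sigma_additive lebesgue_succ.
Proof.
move=> F mF tF mUF; rewrite /lebesgue_succ /pushforward preimage_bigcup.
have mp A : measurable A -> measurable (cons_Rn @^-1` A).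
  by move=> mA; rewrite -[X in measurable X]setTI; exact: measurable_cons_Rn.
apply: measure_semi_sigma_additive.
- by move=> k; exact: mp.
- apply/trivIsetP => /= i j _ _ ij; rewrite -preimage_setI.
  by move/trivIsetP : tF => /(_ _ _ _ _ ij) ->//; rewrite preimage_set0.
- by rewrite -preimage_bigcup; exact: mp.
Qed.

HB.instance Definition _ := isMeasure.Build _ _ _ lebesgue_succ
  lebesgue_succ0 lebesgue_succ_ge0 lebesgue_succ_sigma_additive.

Let lebesgue_succ_sigma_finite : sigma_finite setT lebesgue_succ.
Proof.
have /sigma_finiteP[F [TF ndF Foo]] := sigma_finiteT (@lebesgue_measure R).
have /sigma_finiteP[G [TG ndG Goo]] := sigma_finiteT m.
pose u (t : Rn R n.+1) : measurableTypeR R * Rn R n :=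
  (tnth t ord0, [tuple of behead t]).
have mu : measurable_fun setT u.
  apply/measurable_fun_pairP; split => /=.
  - exact: measurable_tnth.
  - exact: measurable_behead.
have consK p : u (cons_Rn p) = p.
  case: p => x t; rewrite /u /cons_Rn/=; congr (_, _); exact/val_inj.
exists (fun k => u @^-1` (F k `*` G k)).
  rewrite -preimage_bigcup (_ : bigcup _ _ = setT) ?preimage_setT//.
  rewrite -setXTT TF TG predeqE => -[x y]; split.
    by move=> [k _ []/= ? ?]; split; exists k.
  move=> [/= [k _ Fkx] [l _ Gly]]; exists (maxn k l) => //; split.
  - by move: x Fkx; exact/subsetPset/ndF/leq_maxl.
  - by move: y Gly; exact/subsetPset/ndG/leq_maxr.
move=> k; have [mF Fk] := Foo k; have [mG Gk] := Goo k; split.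
  by rewrite -[X in measurable X]setTI; apply: mu => //; exact: measurableX.
rewrite /lebesgue_succ /pushforward (_ : _ @^-1` _ = F k `*` G k); last first.
  rewrite -comp_preimage (_ : u \o cons_Rn = id) ?preimage_id//.
  exact/funext.
by rewrite product_measure1E// lte_mul_pinfty// ge0_fin_numE.
Qed.

HB.instance Definition _ := @Measure_isSigmaFinite.Build _ _ _
  lebesgue_succ lebesgue_succ_sigma_finite.

End lebesgue_succ.

Fixpoint lebesgue_Rn (R : realType) (n : nat) :
    {sigma_finite_measure set (Rn R n) -> \bar R} :=
  match n with
  | 0%N => dirac ([tuple] : Rn R 0)
  | k.+1 => lebesgue_succ (lebesgue_Rn R k)
  end.

Section Rn_functions.
Context (R : realType) (n : nat).
Implicit Types (f g : Rn R n -> R[i]) (x xi : Rn R n).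

Definition dot_Rn x xi : R := \sum_(i < n) tnth x i * tnth xi i.

Definition norm_Rn x : R := Num.sqrt (\sum_(i < n) tnth x i ^+ 2).

Definition sub_Rn x (y : Rn R n) : Rn R n :=
  [tuple tnth x i - tnth y i | i < n].

(* closed axis-parallel cube of side b whose lower corner is a *)
Definition cube (a : Rn R n) (b : R) : set (Rn R n) :=
  [set x | forall i, tnth a i <= tnth x i <= tnth a i + b].

Definition L2norm f : \bar R :=
  Lnorm (lebesgue_Rn R n) 2%:E (fun x => (ComplexField.Normc.normc (f x))%:E).

Definition isL2 f : Prop :=
  [/\ measurable_fun setT (fun x => complex.Re (f x) : R),
      measurable_fun setT (fun x => complex.Im (f x) : R) &
      (L2norm f < +oo)%E].

(* The convention is int f(x) e^{-i x.xi} dx, with no factor 2 pi in the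
   exponent: it is the one for which the inversion formula carries the factor
   (2 pi)^{-n} of the error bound. *)
Definition fourierL1 f xi : R[i] :=
  let F x := f x * (cos (dot_Rn x xi) -i* sin (dot_Rn x xi)) in
  Rintegral (lebesgue_Rn R n) setT (fun x => complex.Re (F x)) +i*
  Rintegral (lebesgue_Rn R n) setT (fun x => complex.Im (F x)).

(* g is (a representative of) the Fourier-Plancherel transform of f in L^2:
   the limit in L^2 of the transforms of the truncations of f to the balls of
   radius k, which are in L^1. *)
Definition is_fourierL2 f g : Prop :=
  isL2 g /\
  (fun k : nat => L2norm (fun xi =>
     g xi - fourierL1 (fun x => if norm_Rn x <= k%:R then f x else 0) xi))
    @ \oo --> 0%E.

(* The space B_sigma; the support condition on the L^2 transform is almost
   everywhere. *)
Definition bandlimited (sigma : R) f : Prop :=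
  isL2 f /\ exists g, is_fourierL2 f g /\
    {ae lebesgue_Rn R n, forall xi, sigma < norm_Rn xi -> g xi = 0}.

Definition gaussian (beta : R) x : R := expR (- beta * norm_Rn x ^+ 2).

Definition gaussian_interpolant (beta : R) (N : nat) (X : 'I_N -> Rn R n)
    f (s : Rn R n -> R[i]) : Prop :=
  (exists c : 'I_N -> R[i],
     forall x, s x = \sum_(j < N) c j * (gaussian beta (sub_Rn x (X j)))%:C) /\
  forall i, s (X i) = f (X i).

End Rn_functions.

(* The value 0 at n = 0 makes the recurrence give gamma_cst 1 = 2. *)
Fixpoint gamma_cst (n : nat) : nat :=
  match n with
  | 0%N => 0%N
  | k.+1 => (2 * k.+1 * (1 + gamma_cst k))%N
  end.

Section constants.
Context (R : realType).
Implicit Types (n : nat) (beta delta sigma : R).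

Local Notation "'e'" := (expR 1 : R).

Definition rho : R := Num.sqrt 3 / e.

(* volume of the unit ball of R^n *)
Definition alpha_cst n : R :=
  fine (lebesgue_Rn R n [set x | norm_Rn x <= 1]).

Definition bound_C n (b0 : R) beta : R :=
  (3 `^ (3 / 4) * e * Num.sqrt (2 * rho * beta) * Num.sqrt n%:R *
   expR (2 * n%:R * (gamma_cst n)%:R)) ^+ 4 * b0 ^+ 3 * (gamma_cst n)%:R.

Definition bound_c n (b0 : R) : R := b0 / (8 * (gamma_cst n)%:R).

Definition delta_cst n (b0 : R) : R :=
  if (n == 1%N) || (n == 2%N) then b0 / (2 * (gamma_cst n)%:R)
  else if odd n then b0 / (2 * (gamma_cst n)%:R * (n%:R - 1))
  else b0 / (2 * (gamma_cst n)%:R * (n%:R - 2)).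

Definition delta0 n (b0 : R) beta : R :=
  Num.min (1 / bound_C n b0 beta) (delta_cst n b0).

Definition beta0 n (b0 : R) delta : R :=
  1 / (3 `^ (3 / 2) * 2 * rho * n%:R *
       expR (4 * n%:R * (gamma_cst n)%:R + 2) * b0 `^ (3 / 2) *
       Num.sqrt (gamma_cst n)%:R * Num.sqrt delta).

Definition Delta'' n : R :=
  if odd n then
    pi `^ (n%:R / 4) * (n%:R * alpha_cst n) `^ (1 / 2) *
    rho `^ ((n%:R - 1) / 4)
  else
    pi `^ ((n%:R - 1) / 4) * (n%:R * alpha_cst n) `^ (1 / 2) *
    2 `^ ((n%:R + 1) / 4) * rho `^ ((n%:R - 2) / 4).

(* Right-hand side of the error bound as a function of beta; [fine] loses
   nothing since the norm is finite for f in L^2. *)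
Definition error_bound n (b0 : R) delta sigma (f : Rn R n -> R[i]) beta : R :=
  Delta'' n * (bound_C n b0 beta * delta) `^ (bound_c n b0 / delta) *
  (2 * pi) ^- n * expR (sigma ^+ 2 / (8 * beta)) * fine (L2norm f).

Definition MN n (b0 : R) delta sigma beta : R :=
  beta `^ (b0 / (4 * (gamma_cst n)%:R * delta)) *
  expR (sigma ^+ 2 / (8 * beta)).

Definition interpolation_conditions n (b0 b : R) delta beta (N : nat)
    (X : 'I_N -> Rn R n) (a : Rn R n) (f s : Rn R n -> R[i]) : Prop :=
  [/\ b0 <= b, 0 < delta <= delta0 n b0 beta, injective X,
      (forall a', cube a' delta `<=` cube a b ->
         exists j, cube a' delta (X j)) &
      gaussian_interpolant beta X f s].

Definition minimizes_on (D : set R) (F : R -> R) (x : R) : Prop :=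
  D x /\ forall y, D y -> F x <= F y.

Lemma gamma_cst_gt0 n : (0 < n)%N -> 0 < (gamma_cst n)%:R :> R.
Proof. by case: n => // n _; rewrite ltr0n /= !muln_gt0. Qed.

Lemma rho_gt0 : 0 < rho.
Proof. by rewrite divr_gt0 ?expR_gt0 ?sqrtr_gt0. Qed.

Lemma bound_C_delta n (b0 : R) delta beta :
  (0 < n)%N -> 0 < b0 -> 0 < delta -> 0 < beta ->
  bound_C n b0 beta * delta = (beta / beta0 n b0 delta) ^+ 2.
Proof.
move=> n0 b00 d0 be0; have g0 := gamma_cst_gt0 n0; have r0 := rho_gt0.
rewrite /bound_C /beta0; set g := (gamma_cst n)%:R.
have -> : 3 `^ (3 / 2) = (3 `^ (3 / 4)) ^+ 2 :> R.
  by rewrite -powR_mulrn ?powR_ge0// -powRrM; congr powR; field.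
have -> : expR (4 * n%:R * g + 2) = e ^+ 2 * expR (2 * n%:R * g) ^+ 2.
  by rewrite -!expRM_natl -expRD; congr expR; ring.
have hb : (b0 `^ (3 / 2)) ^+ 2 = b0 ^+ 3.
  rewrite -powR_mulrn ?powR_ge0// -powRrM -powR_mulrn ?ltW//.
  by congr powR; field.
have hg : Num.sqrt g ^+ 2 = g by rewrite sqr_sqrtr// ltW.
have hd : Num.sqrt delta ^+ 2 = delta by rewrite sqr_sqrtr// ltW.
have hn : Num.sqrt n%:R ^+ 4 = n%:R ^+ 2 :> R.
  by rewrite -[4%N]/(2 * 2)%N exprM sqr_sqrtr.
have hr : Num.sqrt (2 * rho * beta) ^+ 4 = (2 * rho * beta) ^+ 2.
  by rewrite -[4%N]/(2 * 2)%N exprM sqr_sqrtr// !mulr_ge0 ?ltW.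
move: rho r0 hr => r r0 hr; rewrite div1r invrK !exprMn hr hn hb hg hd; ring.
Qed.

(* For fixed delta, the admissible shape parameters are those in (0, beta0]. *)
Lemma le_delta0E n (b0 : R) delta beta :
  (0 < n)%N -> 0 < b0 -> 0 < delta -> 0 < beta ->
  (delta <= delta0 n b0 beta) =
  (delta <= delta_cst n b0) && (beta <= beta0 n b0 delta).
Proof.
move=> n0 b00 d0 be0; have g0 := gamma_cst_gt0 n0; have r0 := rho_gt0.
have B0 : 0 < beta0 n b0 delta.
  rewrite /beta0; move: rho (gamma_cst n) r0 g0 => r g r0; rewrite ltr0n => g0.
  by rewrite divr_gt0// !mulr_gt0 ?powR_gt0 ?expR_gt0 ?sqrtr_gt0 ?ltr0n.
have C0 : 0 < bound_C n b0 beta.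
  have := bound_C_delta n0 b00 d0 be0; rewrite -(pmulr_lgt0 _ d0) => ->.
  by rewrite exprn_gt0// divr_gt0.
rewrite /delta0 le_min andbC; congr andb.
rewrite ler_pdivlMr// mulrC bound_C_delta// expr_le1//.
  by rewrite ler_pdivrMr// mul1r.
by apply: divr_ge0; exact: ltW.
Qed.

End constants.

(* Main.v *)
Require Import Defs.
From mathcomp Require Import all_boot all_order all_algebra.
From mathcomp Require Import ring lra complex.
From mathcomp Require Import all_classical all_reals all_analysis.
Import Order.TTheory GRing.Theory Num.Theory.
Import numFieldNormedType.Exports.
Local Open Scope classical_set_scope.
Local Open Scope ring_scope.

(** With [p = b0 / (4 gamma_n delta)], [bound_C_delta] turns the factor
    [(C delta)^(c / delta)] into [(beta / beta0)^p], so the error bound is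
    [MN] times a constant independent of [beta]. This constant is positive as
    soon as [f] is not null, because the unit ball has positive finite volume.
    The logarithm [p ln beta + k / beta] of [MN], with [k = sigma^2 / 8],
    decreases up to [k / p] and increases afterwards, so that on
    [(0, beta0]] its only minimizer is [min (k / p) beta0]. *)

Section minimization.
Context (R : realType).
Implicit Types p k x y B : R.

(** The strict bound 1 + t < exp t for t != 0, read at t = x - 1. Its strictness is what makes the
    minimizer unique. *)
Lemma ln_lt_sub1 x : 0 < x -> x != 1 -> ln x < x - 1.
Proof.
move=> x0 x1; rewrite -ltr_expR lnK ?posrE//.
by rewrite -[ltLHS](subrKC 1) expR_gt1Dx// subr_eq0.
Qed.

(** In place of a study of the derivative: multiplying ln (y/x) < y/x - 1 by p leaves p (y/x - 1) <=
    (k/y) (y/x - 1) to be shown, and the right-hand side is k/x - k/y. *)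
Lemma lt_powR_expR_min p k B x (y := Num.min (k / p) B) :
  0 < p -> 0 < k -> 0 < x <= B -> x != y ->
  y `^ p * expR (k / y) < x `^ p * expR (k / x).
Proof.
move=> p0 k0 /andP[x0 xB] xy.
have B0 := lt_le_trans x0 xB.
have y0 : 0 < y by rewrite lt_min divr_gt0.
(* Both bases are nonzero, so [powR] is exp (p ln _) and only the exponents are compared. *)
rewrite /powR !gt_eqF// -!expRD ltr_expR.
have yx1 : y / x != 1.
  by apply: contra xy => /eqP yx; rewrite -[y](divfK (lt0r_neq0 x0)) yx mul1r.
have := ln_lt_sub1 (y / x) (divr_gt0 y0 x0) yx1.
rewrite ln_div ?posrE// -(ltr_pM2l p0) => ineq.
(* If y = k/p, the first factor vanishes. Otherwise y = B < k/p and both factors are nonnegative,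
   since p <= k/B and x <= B. *)
have slope : 0 <= (k / y - p) * (y / x - 1).
  rewrite {}/y in y0 xy yx1 ineq *.
  have [kpB|Bkp] := leP (k / p) B.
    by rewrite invf_div mulrCA mulfV ?gt_eqF// mulr1 subrr mul0r.
  rewrite mulr_ge0// subr_ge0.
    by rewrite ler_pdivlMr// mulrC -ler_pdivlMr// ltW.
  by rewrite ler_pdivlMr// mul1r.
have kx : k / x = k / y * (y / x) by rewrite mulrA divfK// gt_eqF.
rewrite kx; lra.
Qed.

Lemma minimizes_on_unique (D : set R) (F : R -> R) x y :
  minimizes_on D F x -> (forall z, D z -> z != x -> F x < F z) ->
  minimizes_on D F y -> y = x.
Proof.
move=> [Dx _] lt_x [Dy Fy]; apply/eqP/negPn/negP => /(lt_x _ Dy).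
by rewrite ltNge Fy.
Qed.

End minimization.

Section volume.
Context (R : realType).

Lemma measurable_cube n (a : Rn R n) (b : R) : measurable (cube a b).
Proof.
have -> : cube a b = \bigcap_(i in [set: 'I_n])
    (fun x : Rn R n => tnth x i) @^-1` `[tnth a i, tnth a i + b].
  apply/seteqP; split => [x xab i _|x xab i] /=.
    by rewrite in_itv/=; exact: xab.
  by have := xab i I; rewrite /= in_itv.
apply: fin_bigcap_measurable => // i _.
by rewrite -[X in measurable X]setTI; apply: measurable_tnth.
Qed.

(** Induction on n: [cons_Rn] pulls the cube back to an interval times a cube of one dimension less.
    The base case is the Dirac mass at the empty tuple. *)
Lemma lebesgue_Rn_cube n (a : Rn R n) (b : R) : 0 < b ->
  lebesgue_Rn R n (cube a b) = (b ^+ n)%:E.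
Proof.
move=> b0; elim: n a => [|n IH] a.
  by rewrite /= diracE mem_set ?expr0// => -[].
have cons_cube : @cons_Rn R n @^-1` cube a b =
    `[tnth a ord0, tnth a ord0 + b] `*` cube [tuple of behead a] b.
  apply/seteqP; split => [[x t] /= xab|[x t] /= [xab tab] i].
    split; first by have := xab ord0; rewrite tnth0 in_itv.
    by move=> i; have := xab (lift ord0 i); rewrite tnthS tnth_behead
      (_ : inord _ = lift ord0 i)//; apply/val_inj; rewrite /= inordK// ltnS.
  case: (unliftP ord0 i) => [j ->|->]; last by move: xab; rewrite tnth0 in_itv.
  have := tab j; rewrite tnthS tnth_behead (_ : inord _ = lift ord0 j)//.
  by apply/val_inj; rewrite /= inordK// ltnS.
transitivity ((lebesgue_measure \x lebesgue_Rn R n)%E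
    (@cons_Rn R n @^-1` cube a b)); first by [].
rewrite cons_cube product_measure1E ?IH; [|exact: measurable_itv|exact: measurable_cube].
transitivity (b%:E * (b ^+ n)%:E)%E; last by rewrite -EFinM exprS.
congr (_ * _)%E.
apply: etrans (lebesgue_measure_itv `[tnth a ord0, tnth a ord0 + b]) _.
by rewrite /= lte_fin ltrDl b0 -EFinB addrAC subrr add0r.
Qed.

Lemma norm_Rn_le1 n (x : Rn R n) :
  (norm_Rn x <= 1) = (\sum_(i < n) tnth x i ^+ 2 <= 1).
Proof. by rewrite /norm_Rn -[X in _ <= X]sqrtr1 ler_sqrt. Qed.

Lemma measurable_unit_ball n : measurable [set x : Rn R n | norm_Rn x <= 1].
Proof.
have -> : [set x : Rn R n | norm_Rn x <= 1] =
    setT `&` [set x | \sum_(i < n) tnth x i ^+ 2 <= 1].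
  by rewrite setTI; apply/seteqP; split => x /=; rewrite norm_Rn_le1.
apply: measurable_fun_le => //; apply: measurable_sum => i.
apply: (measurableT_comp (measurable_realfun.exprn_measurable 2)).
exact: measurable_tnth.
Qed.

(** The ball contains a cube of side 1/n and lies in one of side 2. Finiteness matters as much as
    positivity, because [fine] sends an infinite volume to 0. *)
Lemma alpha_cst_gt0 n : (0 < n)%N -> 0 < alpha_cst R n.
Proof.
move=> n0; apply: fine_gt0; apply/andP; split.
  pose r : R := n%:R^-1.
  have r0 : 0 < r by rewrite invr_gt0 ltr0n.
  have r1 : r <= 1 by rewrite invf_le1 ?ler1n ?ltr0n.
  apply: (@lt_le_trans _ _
    (lebesgue_Rn R n (cube [tuple of nseq n (0 : measurableTypeR R)] r))).
    by rewrite lebesgue_Rn_cube// lte_fin exprn_gt0.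
  apply: le_measure; rewrite ?inE; [exact: measurable_cube|
    exact: measurable_unit_ball|].
  move=> x xr /=; rewrite norm_Rn_le1.
  (* A coordinate in [0, r] with r <= 1 has square at most r, and n copies of r = 1/n add up to
     1. *)
  apply: (@le_trans _ _ (\sum_(i < n) r)).
    apply: ler_sum => i _; have := xr i; rewrite tnth_nseq add0r => /andP[x0 xr'].
    rewrite expr2; apply: (le_trans _ xr'); rewrite ler_piMl//.
    exact: le_trans xr' r1.
  by rewrite sumr_const card_ord -mulr_natr mulVf// pnatr_eq0 -lt0n.
apply: (@le_lt_trans _ _
  (lebesgue_Rn R n (cube [tuple of nseq n (-1 : measurableTypeR R)] 2))).
  apply: le_measure; rewrite ?inE; [exact: measurable_unit_ball|
    exact: measurable_cube|].
  move=> x /=; rewrite norm_Rn_le1 => x1 i.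
  rewrite tnth_nseq.
  have : tnth x i ^+ 2 <= 1.
    apply: le_trans x1; rewrite (bigD1 i)//= lerDl.
    by apply: sumr_ge0 => j _; exact: sqr_ge0.
  rewrite -[_ ^+ 2]ger0_norm ?sqr_ge0// normrX expr_le1// ler_norml; lra.
by rewrite lebesgue_Rn_cube// ltry.
Qed.

End volume.

Section error_bound.
Context (R : realType) (n : nat) (b0 delta sigma : R).
Hypotheses (n_gt0 : (0 < n)%N) (b0_gt0 : 0 < b0) (delta_gt0 : 0 < delta).

Lemma Delta''_gt0 : 0 < Delta'' R n.
Proof.
have na0 : 0 < n%:R * alpha_cst R n.
  by rewrite mulr_gt0 ?ltr0n ?alpha_cst_gt0.
by rewrite /Delta''; case: ifP => _;
  rewrite !mulr_gt0 ?powR_gt0 ?pi_gt0 ?rho_gt0.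
Qed.

Lemma beta0_gt0 : 0 < beta0 n b0 delta.
Proof.
have g0 := gamma_cst_gt0 R n_gt0; have r0 := rho_gt0 R.
rewrite /beta0; move: (rho R) r0 (gamma_cst n)%:R g0 => r r0 g g0.
by rewrite divr_gt0// !mulr_gt0 ?powR_gt0 ?expR_gt0 ?sqrtr_gt0 ?ltr0n.
Qed.

Lemma error_boundE (f : Rn R n -> R[i]) beta : 0 < beta ->
  error_bound b0 delta sigma f beta =
  Delta'' R n * (beta0 n b0 delta)^-1 `^ (b0 / (4 * (gamma_cst n)%:R * delta)) *
  (2 * pi) ^- n * fine (L2norm f) * MN n b0 delta sigma beta.
Proof.
move=> be0; have g0 := gamma_cst_gt0 R n_gt0.
rewrite /error_bound /MN bound_C_delta//.
have B0 := beta0_gt0; have BV0 : 0 <= (beta0 n b0 delta)^-1.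
  by rewrite invr_ge0 ltW.
rewrite -powR_mulrn; last by rewrite mulr_ge0// ltW.
rewrite -powRrM powRM ?(ltW be0)//.
(* The square in [bound_C_delta] doubles c / delta into the exponent of [MN]. *)
have -> : 2%:R * (bound_c n b0 / delta) =
    b0 / (4 * (gamma_cst n)%:R * delta) :> R.
  by rewrite /bound_c; field; rewrite !gt_eqF.
ring.
Qed.

End error_bound.

(** Uniqueness for the error bound is restricted to f of nonzero norm: for a null f the bound
    vanishes at every admissible beta, and each of them minimizes it. *)
Theorem mainTheorem1 (R : realType) (n : nat) (sigma b0 b delta : R)
    (f : Rn R n -> R[i]) (N : nat) (X : 'I_N -> Rn R n) (a : Rn R n)
    (s : R -> Rn R n -> R[i])
    (n_ge1 : (1 <= n)%N) (sigma_gt0 : 0 < sigma) (b0_gt0 : 0 < b0)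
    (delta_gt0 : 0 < delta)
    (f_band : bandlimited sigma f)
    (interp : forall beta : R, 0 < beta <= beta0 n b0 delta ->
       interpolation_conditions b0 b delta beta X a f (s beta)) :
  let I := [set beta : R | 0 < beta <= beta0 n b0 delta] in
  exists beta_opt : R,
    [/\ (forall beta, minimizes_on I (MN n b0 delta sigma) beta <->
                      beta = beta_opt),
        minimizes_on I (error_bound b0 delta sigma f) beta_opt &
        (L2norm f <> 0%E ->
         forall beta, minimizes_on I (error_bound b0 delta sigma f) beta ->
                      beta = beta_opt)].
Proof.
have g0 := gamma_cst_gt0 R n_ge1.
set p := b0 / (4 * (gamma_cst n)%:R * delta).
have p0 : 0 < p by rewrite divr_gt0// !mulr_gt0.
pose k := sigma ^+ 2 / 8.
have k0 : 0 < k by rewrite divr_gt0// exprn_gt0.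
have MNE beta : MN n b0 delta sigma beta = beta `^ p * expR (k / beta).
  by rewrite /MN /k [(8 * beta)^-1]invfM (mulrA (sigma ^+ 2)).
move=> I; have B0 := beta0_gt0 R n b0 delta n_ge1 b0_gt0 delta_gt0.
pose y := Num.min (k / p) (beta0 n b0 delta).
have Iy : I y by rewrite /I/= lt_min divr_gt0//= B0 ge_min lexx orbT.
have lt_MN z : I z -> z != y -> MN n b0 delta sigma y < MN n b0 delta sigma z.
  by move=> Iz zy; rewrite !MNE lt_powR_expR_min.
have min_MN : minimizes_on I (MN n b0 delta sigma) y.
  split=> // z Iz; have [->//|zy] := eqVneq z y.
  exact/ltW/lt_MN.
(* The norm of f is kept out of K, which is thus positive even for a null f. *)
pose K := Delta'' R n * (beta0 n b0 delta)^-1 `^ p * (2 * pi) ^- n.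
have EE z : I z -> error_bound b0 delta sigma f z =
    K * fine (L2norm f) * MN n b0 delta sigma z.
  by move=> /andP[z0 _]; exact: error_boundE.
have K0 : 0 < K.
  rewrite mulr_gt0 ?invr_gt0 ?exprn_gt0 ?mulr_gt0 ?pi_gt0 ?Delta''_gt0//.
  by rewrite powR_gt0 ?invr_gt0.
have min_E : minimizes_on I (error_bound b0 delta sigma f) y.
  split=> // z Iz; rewrite !EE// ler_wpM2l//; last exact: min_MN.2.
  by rewrite mulr_ge0 ?(ltW K0)// fine_ge0// Lnorm_ge0.
exists y; split=> //.
  by move=> z; split=> [|->//]; exact: minimizes_on_unique min_MN lt_MN.
move=> f0 z; apply: (minimizes_on_unique _ _ _ _ _ min_E) => {}z Iz zy.
rewrite !EE// ltr_pM2l; first exact: lt_MN.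
(* The norm is finite because f is in L^2, and nonzero by [f0]. *)
rewrite mulr_gt0// fine_gt0//; have [[_ _ ->] _] := f_band.
by rewrite andbT lt_neqAle Lnorm_ge0 andbT eq_sym; apply/eqP.
Qed.
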